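(* Let $n\ge1$, let $G=\mathrm{PSL}(2,2^n)$ act on $X=\mathrm{GF}(2^n)\cup\{\infty\}$, and let $B$ be a $13$-subset of $X$. Suppose that the orbit $G(B)$ forms a $3$-$(2^n+1,13,\lambda_B)$ design. Then \[\lambda_B\in\{66,78,143,429,572,858,1716\}.\]
   Context: $\mathrm{PSL}(2,2^n)$ is the group of all maps $X\to X$, $x\mapsto\frac{ax+b}{cx+d}$ with $a,b,c,d\in\mathrm{GF}(2^n)$, $ad-bc\neq0$ (usual conventions for $\infty$). For a $13$-subset $B$ of $X$, $G(B)=\{g(B): g\in G\}$ is its orbit. A set $\mathcal B$ of $13$-subsets of $X$ forms a $3$-$(2^n+1,13,\lambda)$ design if every $3$-subset of $X$ is contained in exactly $\lambda$ members of $\mathcal B$. *)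

(* Defs.v *)
From HB Require Import structures.
From mathcomp Require Import all_boot all_order all_algebra all_fingroup.
From mathcomp Require Import ring.

Set Implicit Arguments.
Unset Strict Implicit.
Unset Printing Implicit Defensive.

Import GRing.Theory.

Section ProjectiveLine.

Variable F : finFieldType.
Local Open Scope ring_scope.

(* The projective line over F is [option F], with [None] the point at infinity;
   u / v is infinity when v = 0 (only ever used with (u, v) != (0, 0)). *)
Definition ratio (u v : F) : option F :=
  if v == 0 then None else Some (u / v).

Definition mobius (a b c d : F) (x : option F) : option F :=
  if x is Some y then ratio (a * y + b) (c * y + d) else ratio a c.

(* The determinant is only required to be nonzero, as is right for q even:
   every element of F is then a square.  For q odd this would be PGL(2, q). *)
Definition PSL2 : {set {perm option F}} :=
  [set s : {perm option F} | [exists a : F, exists b : F, exists c : F,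
     exists d : F, (a * d - b * c != 0) && [forall x, s x == mobius a b c d x]]].

Lemma PSL2P (s : {perm option F}) :
  reflect (exists a b c d : F, a * d - b * c != 0 /\ s =1 mobius a b c d)
          (s \in PSL2).
Proof.
rewrite inE; apply: (iffP existsP) => [[a] | [a [b [c [d [nz sE]]]]]].
  case/existsP=> b /existsP[c] /existsP[d] /andP[nz /forallP sE].
  by exists a, b, c, d; split=> // x; apply/eqP.
exists a; apply/existsP; exists b; apply/existsP; exists c.
apply/existsP; exists d; rewrite nz; apply/forallP=> x; exact/eqP.
Qed.

Lemma ratioZ (k u v : F) : k != 0 -> ratio (k * u) (k * v) = ratio u v.
Proof.
move=> nzk; rewrite /ratio mulf_eq0 (negPf nzk) /=.
by case: eqP => // /eqP nzv; rewrite -mulf_div divff ?mul1r.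
Qed.

Lemma mobius_ratio (a b c d u v : F) : (u != 0) || (v != 0) ->
  mobius a b c d (ratio u v) = ratio (a * u + b * v) (c * u + d * v).
Proof.
rewrite {1}/ratio; have [-> | nzv _] := eqVneq v 0.
  by rewrite orbF => nzu /=; rewrite !mulr0 !addr0 ![_ * u]mulrC ratioZ.
by rewrite /= -(ratioZ _ _ nzv); congr ratio; field.
Qed.

Lemma mobius_comp (a b c d a' b' c' d' : F) (x : option F) :
    a' * d' - b' * c' != 0 ->
  mobius a b c d (mobius a' b' c' d' x)
    = mobius (a * a' + b * c') (a * b' + b * d')
             (c * a' + d * c') (c * b' + d * d') x.
Proof.
move=> nz; case: x => [y|] /=; rewrite mobius_ratio.
- by congr ratio; ring.
- rewrite -negb_and; apply: contra nz => /andP[/eqP u0 /eqP v0].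
  have -> : a' * d' - b' * c'
      = a' * (c' * y + d') - c' * (a' * y + b') by ring.
  by rewrite u0 v0 !mulr0 subrr.
- by [].
- rewrite -negb_and; apply: contra nz => /andP[/eqP-> /eqP->].
  by rewrite mul0r mulr0 subrr.
Qed.

Lemma mobius_scalar (k : F) : k != 0 -> mobius k 0 0 k =1 id.
Proof.
move=> nzk [y|]; rewrite /mobius /ratio ?eqxx //.
by rewrite mul0r add0r addr0 (negPf nzk) mulrC mulKf.
Qed.

Lemma mobius_inj (a b c d : F) : a * d - b * c != 0 -> injective (mobius a b c d).
Proof.
move=> nz; apply: (can_inj (g := mobius d (- b) (- c) a)) => x.
rewrite mobius_comp // -[RHS](mobius_scalar nz).
by congr mobius; ring.
Qed.

Lemma PSL2_group_set : group_set PSL2.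
Proof.
apply/group_setP; split.
  apply/PSL2P; exists 1, 0, 0, 1; rewrite mulr1 mulr0 subr0 oner_neq0.
  by split=> // x; rewrite perm1 mobius_scalar ?oner_neq0.
move=> s t /PSL2P[a' [b' [c' [d' [nz' sE]]]]] /PSL2P[a [b [c [d [nz tE]]]]].
apply/PSL2P; exists (a * a' + b * c'), (a * b' + b * d').
exists (c * a' + d * c'), (c * b' + d * d'); split.
  have -> : (a * a' + b * c') * (c * b' + d * d')
      - (a * b' + b * d') * (c * a' + d * c')
      = (a * d - b * c) * (a' * d' - b' * c') by ring.
  exact: mulf_neq0.
by move=> x; rewrite permM sE tE mobius_comp.
Qed.

Canonical PSL2_group := Group PSL2_group_set.

End ProjectiveLine.

Definition is_design (T : finType) (t v k lambda : nat) (D : {set {set T}}) : Prop :=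
  [/\ #|T| = v,
      forall A : {set T}, A \in D -> #|A| = k
    & forall S : {set T}, #|S| = t -> #|[set A in D | S \subset A]| = lambda].

(* Main.v *)
Require Import Defs.
From mathcomp Require Import all_boot all_order all_algebra all_fingroup.
From mathcomp Require Import all_solvable all_field.
From mathcomp Require Import ring zify.

Set Implicit Arguments.
Unset Strict Implicit.
Unset Printing Implicit Defensive.

Import GRing.Theory.

(** PSL(2, q), q = 2 ^ n, acts sharply 3-transitively on the projective line.
Count the elements s of the group for which the block s(B) contains the points
oo, 0, 1: sending s to the preimages of these points identifies them with the
13 * 12 * 11 = 1716 ordered triples of distinct points of B, while each of the
lambda blocks through oo, 0, 1 equals s(B) for |H| elements s, where H is the
stabilizer of B. Hence lambda * |H| = 1716 ([design_index_stab]), and what has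
to be shown is that |H| is one of 1, 2, 3, 4, 12, 22, 26.

The divisors of 1716 to be discarded are excluded by looking at fixed points.
A nontrivial element fixes at most two points, and in characteristic 2 the
nontrivial elements fixing exactly one point are the involutions having a
fixed point. So, on the 13 points of B, an involution and an element of order 3
each fix one point, an element of order 11 two and an element of order 13 none.

- Order 6 ([card_stab_neq6]): an involution of H would normalize the subgroup
  of order 3, hence permute its two fixed points on the line; exactly one of
  these is in B, so both would be fixed by the involution.
- If g in H has prime order 11 or 13, then g permutes the points of B that it
  moves in a single cycle. Any point x moved by g is fixed by some involution t
  inverting g ([inverting_involution]); t reverses this cycle, so t preserves B
  and H has even order ([stab_inverting]).
- If 11 divides |H| ([card_stab_11]), no involution of H fixes either of the
  two fixed points of g: the involutions of H at such a point, together with 1,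
  form a 2-group of order at most 4, so g centralizes it and its elements fix
  both fixed points of g, which no involution does. Since every involution of H
  fixes a point of B, H cannot move a fixed point of g to a point moved by g.
  So H permutes these two points, and counting orbits gives |H| <= 2 * 11.
- If 13 but not 11 divides |H| ([card_stab_13]), Sylow's theorem makes the
  subgroup P of order 13 normal. As P is transitive on B, the stabilizer in H
  of a point x of B embeds into the cyclic group Aut P. It contains an
  involution, which is a power of a generator; hence this generator fixes no
  point of the line but x, so it is itself an involution and |H| = 26. *)

(** * Moebius maps and fixed points *)

Section SharplyThreeTransitive.
Local Open Scope group_scope.

Variable F : finFieldType.
Implicit Types (s t w : {perm option F}) (x y z : option F).

Local Notation G := (PSL2 F).

Lemma mobius_perm (a b c d : F) : (a * d - b * c != 0)%R ->
  exists2 s, s \in G & s =1 mobius a b c d.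
Proof.
move=> nz; exists (perm (mobius_inj nz)); last by move=> x; rewrite permE.
by apply/PSL2P; exists a, b, c, d; split=> // x; rewrite permE.
Qed.

(** Moving three given points to oo, 0 and 1 reduces each fixed point question
below to a computation with an affine map. *)
Lemma PSL2_frame x y z : uniq [:: x; y; z] ->
  exists2 w, w \in G & [/\ w None = x, w (Some 0%R) = y & w (Some 1%R) = z].
Proof.
move=> xyz.
(* First send oo to x, then adjust 0 and 1 by an affine map. *)
have [s1 s1G s1x] : exists2 s, s \in G & s None = x.
  case: x {xyz} => [v|]; last by exists 1; rewrite ?group1 ?perm1.
  have [|s sG sE] := @mobius_perm v 1%R 1%R 0%R.
    by rewrite mulr0 mulr1 sub0r oppr_eq0 oner_neq0.
  by exists s => //; rewrite sE /= /Defs.ratio oner_eq0 divr1.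
move: xyz; rewrite -s1x -(permKV s1 y) -(permKV s1 z).
rewrite -[[:: _; _; _]]/(map s1 [:: None; s1^-1 y; s1^-1 z]).
rewrite (map_inj_uniq (@perm_inj _ s1)) /= !inE.
case: (s1^-1 y) => [u|] //; case: (s1^-1 z) => [v|] //=.
rewrite andbT => nuv.
have [|s2 s2G s2E] := @mobius_perm (v - u)%R u 0%R 1%R.
  by rewrite mulr0 subr0 mulr1 subr_eq0 eq_sym; apply: contra nuv => /eqP->.
exists (s2 * s1); first exact: groupM.
split; rewrite permM s2E /=; congr (s1 _);
  by rewrite /Defs.ratio ?eqxx // mul0r add0r oner_eq0 divr1
    ?mulr0 ?add0r ?mulr1 ?subrK.
Qed.

Lemma PSL2_pair x y : x != y ->
  exists2 w, w \in G & w None = x /\ w (Some 0%R) = y.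
Proof.
move=> nxy; suff [z xyz] : exists z, uniq [:: x; y; z].
  by have [w wG [wx wy _]] := PSL2_frame xyz; exists w.
case: (pickP (predC (mem [:: x; y]))) => [z | no].
  rewrite /= !inE !negb_or => /andP[zx zy].
  by exists z; rewrite /= !inE !negb_or nxy ![_ == z]eq_sym zx zy.
have: uniq [:: None; Some 0%R; Some 1%R : option F].
  by rewrite /= !inE !andbT /=; apply/eqP=> -[/eqP]; rewrite eq_sym oner_eq0.
move/(@uniq_leq_size _ _ [:: x; y]) => too_small.
by suff: false by []; apply: too_small => u _; apply/negbFE/no.
Qed.

Lemma PSL2_point x : exists2 w, w \in G & w None = x.
Proof.
have [y nxy] : exists y, x != y.
  by case: x => [v|]; [exists None | exists (Some 0%R)].
by have [w wG [wx _]] := PSL2_pair nxy; exists w.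
Qed.

Lemma conjVE s w x : (s ^ w^-1) x = w^-1 (s (w x)).
Proof. by rewrite /conjg invgK !permM. Qed.

Lemma affineP s : s \in G -> s None = None ->
  exists a b : F, a != 0%R /\ forall u, s (Some u) = Some (a * u + b)%R.
Proof.
move=> /PSL2P[a [b [c [d [nz sE]]]]] sinf.
have c0 : c = 0%R.
  by move: sinf; rewrite sE /= /Defs.ratio; case: eqP.
move: nz sE; rewrite c0 mulr0 subr0 mulf_eq0 negb_or => /andP[nza nzd] sE.
exists (a / d)%R, (b / d)%R; rewrite mulf_neq0 ?invr_eq0 //; split=> // u.
by rewrite sE /= /Defs.ratio mul0r add0r (negPf nzd); congr Some; field.
Qed.

Lemma conj_affine s x w : s \in G -> w \in G -> w None = x -> s x = x ->
  exists a b : F, a != 0%R /\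
    forall u, (s ^ w^-1) (Some u) = Some (a * u + b)%R.
Proof.
move=> sG wG wx sx; apply: affineP; first by rewrite groupJ ?groupV.
by rewrite conjVE wx sx -wx permK.
Qed.

Lemma fix3_eq1 s x y z : s \in G -> uniq [:: x; y; z] ->
  s x = x -> s y = y -> s z = z -> s = 1.
Proof.
move=> sG xyz sx sy sz; have [w wG [wx wy wz]] := PSL2_frame xyz.
have [a [b [_ sE]]] := conj_affine sG wG wx sx.
have b0 : b = 0%R.
  by have := sE 0%R; rewrite conjVE wy sy -wy permK mulr0 add0r => -[].
have a1 : a = 1%R.
  by have := sE 1%R; rewrite conjVE wz sz -wz permK b0 addr0 mulr1 => -[].
apply/eqP; rewrite -(conjg_eq1 s w^-1); apply/eqP/permP=> -[u|]; rewrite perm1.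
  by rewrite sE b0 a1 mul1r addr0.
by rewrite conjVE wx sx -wx permK.
Qed.

Lemma PSL2_eq3 s t x y z : s \in G -> t \in G -> uniq [:: x; y; z] ->
  s x = t x -> s y = t y -> s z = t z -> s = t.
Proof.
move=> sG tG xyz ex ey ez; apply/eqP; rewrite eq_mulgV1; apply/eqP.
apply: (fix3_eq1 (x := x) (y := y) (z := z)) => //; first by rewrite groupM ?groupV.
all: by rewrite permM ?ex ?ey ?ez permK.
Qed.

Lemma PSL2_3trans x y z x' y' z' : uniq [:: x; y; z] -> uniq [:: x'; y'; z'] ->
  exists2 s, s \in G & [/\ s x = x', s y = y' & s z = z'].
Proof.
move=> /PSL2_frame[w wG [<- <- <-]] /PSL2_frame[w' wG' [<- <- <-]].
by exists (w^-1 * w'); rewrite ?groupM ?groupV // !permM !permK.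
Qed.

(** In coordinates where the swapped points are oo and 0 the map is k / u. *)
Lemma swap_involution s x y : s \in G -> x != y ->
  s x = y -> s y = x -> s * s = 1.
Proof.
move=> sG nxy sx sy; have [w wG [wx wy]] := PSL2_pair nxy.
have s'G : s ^ w^-1 \in G by rewrite groupJ ?groupV.
have /PSL2P[a [b [c [d [nz sE]]]]] := s'G.
have := sE None; rewrite conjVE wx sx -wy permK /= /Defs.ratio.
have [//|nzc [/esym/eqP]] := eqVneq c 0%R.
rewrite mulf_eq0 invr_eq0 (negPf nzc) orbF => /eqP a0.
have := sE (Some 0%R); rewrite conjVE wy sy -wx permK /= /Defs.ratio !mulr0 !add0r.
have [d0 _|//] := eqVneq d 0%R.
apply/eqP; rewrite -(conjg_eq1 _ w^-1) conjMg; apply/eqP/permP=> u.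
rewrite permM !sE mobius_comp // perm1 a0 d0 !mul0r !mulr0 !add0r !addr0.
rewrite [(c * b)%R]mulrC mobius_scalar //.
by move: nz; rewrite a0 mul0r sub0r oppr_eq0.
Qed.

(** The involution is the map fixing x and exchanging g(x) with g^-1(x). Then
g t exchanges x and g^-1(x), so it is an involution as well, and this means
that t inverts g. *)
Lemma inverting_involution g x : g \in G -> g x != x -> g (g x) != x ->
  exists t, [/\ t \in G, t != 1, t * t = 1, t x = x & g ^ t = g^-1].
Proof.
move=> gG gx ggx; set x1 := g x; set x2 := g^-1 x.
have x10 : x1 != x := gx.
have x21 : x2 != x1 by apply: contra ggx => /eqP e; rewrite -/x1 -e permKV.
have x20 : x2 != x by apply: contra gx => /eqP e; rewrite -{1}e permKV.
have xyz : uniq [:: x; x1; x2].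
  by rewrite /= !inE negb_or ![x == _]eq_sym [x1 == x2]eq_sym x10 x20 x21.
have xzy : uniq [:: x; x2; x1].
  by rewrite /= !inE negb_or ![x == _]eq_sym x10 x20 x21.
have [t tG [tx t1 t2]] := PSL2_3trans xyz xzy.
have tt : t * t = 1.
  by apply: (fix3_eq1 _ xyz); rewrite ?groupM ?permM ?tx ?t1 ?t2.
exists t; split=> //.
  by apply: contra x21 => /eqP t_1; rewrite -t1 t_1 perm1.
have gt : (g * t) * (g * t) = 1.
  apply: (swap_involution (x := x) (y := x2)); rewrite ?groupM 1?eq_sym //.
    by rewrite permM t1.
  by rewrite permM permKV tx.
have tV : t^-1 = t by apply/eqP; rewrite eq_sym eq_mulgV1 invgK tt.
have gtg : g * t * g = t.
  by apply/eqP; rewrite -{2}tV eq_mulgV1 invgK -!mulgA mulgA gt.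
by apply/eqP; rewrite eq_mulgV1 invgK /conjg tV -mulgA gtg tt.
Qed.

(** * Involutions in characteristic 2 *)

Hypothesis char2 : 2 \in [pchar F]%R.

(** The multiplier a of an affine involution satisfies (a + 1)^2 = 0. *)
Lemma conj_translation s x w : s \in G -> w \in G -> w None = x -> s x = x ->
  s * s = 1 -> exists b : F, forall u, (s ^ w^-1) (Some u) = Some (u + b)%R.
Proof.
move=> sG wG wx sx ss; have [a [b [_ sE]]] := conj_affine sG wG wx sx.
have s2 u : (s ^ w^-1) ((s ^ w^-1) (Some u)) = Some u.
  by rewrite -permM -conjMg ss conj1g perm1.
suff a1 : a = 1%R by exists b => u; rewrite sE a1 mul1r.
have := s2 0%R; rewrite !sE => -[e0]; have := s2 1%R; rewrite !sE => -[e1].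
suff: ((a + 1) * (a + 1) = 0)%R.
  move/eqP; rewrite mulf_eq0 orbb -(addrr_pchar2 char2 1%R).
  by move=> /eqP/addIr.
rewrite (_ : ((a + 1) * (a + 1) = (a * (a * 1 + b) + b)
     - (a * (a * 0 + b) + b) + (a + a) + 1)%R); last by ring.
by rewrite e0 e1 subr0 !(addrr_pchar2 char2) addr0 (addrr_pchar2 char2).
Qed.

Lemma involution_fix1 s x y : s \in G -> s * s = 1 ->
  x != y -> s x = x -> s y = y -> s = 1.
Proof.
move=> sG ss nxy sx sy; have [w wG [wx wy]] := PSL2_pair nxy.
have [b sE] := conj_translation sG wG wx sx ss.
have b0 : b = 0%R.
  by have := sE 0%R; rewrite conjVE wy sy -wy permK add0r => -[].
apply/eqP; rewrite -(conjg_eq1 s w^-1); apply/eqP/permP=> -[u|]; rewrite perm1.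
  by rewrite sE b0 addr0.
by rewrite conjVE wx sx -wx permK.
Qed.

Lemma involutions_commute s t x : s \in G -> t \in G ->
  s * s = 1 -> t * t = 1 -> s x = x -> t x = x -> s * t = t * s.
Proof.
move=> sG tG ss tt sx tx; have [w wG wx] := PSL2_point x.
have [b sE] := conj_translation sG wG wx sx ss.
have [c tE] := conj_translation tG wG wx tx tt.
apply: (@conjg_inj _ w^-1); rewrite !conjMg; apply/permP=> -[u|].
  by rewrite permM [RHS]permM !(sE, tE) addrAC.
by rewrite permM [RHS]permM !conjVE wx sx tx -wx !permK wx !(sx, tx).
Qed.

(** An affine map u |-> a u + b with a != 1 has the second fixed point
b / (1 - a), so s is conjugate to a translation. *)
Lemma fix1_involution s x : s \in G -> s x = x ->
  (forall y, s y = y -> y = x) -> s * s = 1.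
Proof.
move=> sG sx only_x; have [w wG wx] := PSL2_point x.
have [a [b [_ sE]]] := conj_affine sG wG wx sx.
have a1 : a = 1%R.
  apply/eqP; apply/negPn/negP=> na1.
  have nz : (1 - a != 0)%R by rewrite subr_eq0 eq_sym.
  have /only_x : s (w (Some (b / (1 - a))%R)) = w (Some (b / (1 - a))%R).
    apply: (canRL (permKV w)); rewrite -conjVE sE; congr Some.
    by field.
  by rewrite -wx => /perm_inj.
apply/eqP; rewrite -(conjg_eq1 _ w^-1) conjMg; apply/eqP/permP=> -[u|].
  rewrite permM !sE a1 !mul1r -addrA (addrr_pchar2 char2) addr0 perm1 //.
by rewrite permM !conjVE wx sx -wx permK wx sx -wx permK perm1.
Qed.

End SharplyThreeTransitive.

(** * The stabilizer of a block *)

Section BlockStabilizer.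
Local Open Scope group_scope.

Variable F : finFieldType.
Hypothesis char2 : 2 \in [pchar F]%R.
Implicit Types (g s t : {perm option F}) (x y z : option F).

Local Notation G := (PSL2 F).
Local Notation Fix g := (afix 'P [set g]).

Lemma in_Fix g x : (x \in Fix g) = (g x == x).
Proof. exact/afix1P/eqP. Qed.

Lemma card_Fix_le2 g : g \in G -> g != 1 -> #|Fix g| <= 2.
Proof.
move=> gG ng1; rewrite leqNgt; apply/card_gt2P=> -[x [y [z []]]].
rewrite !in_Fix => -[/eqP gx /eqP gy /eqP gz] [xy yz zx].
case/eqP: ng1; apply: (fix3_eq1 gG (x := x) (y := y) (z := z)) => //.
by rewrite /= !inE negb_or xy yz eq_sym zx.
Qed.

Lemma Fix_norm g t x : t \in 'N(<[g]>) -> x \in Fix g -> t x \in Fix g.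
Proof.
move=> tN; have tS : [set t] \subset 'N(<[g]>) by rewrite sub1set.
have /actsP/(_ t (set11 t) x) := acts_fix_norm 'P tS.
by rewrite afix_cycle => ->.
Qed.

(** Normalizing <g>, t permutes the two fixed points of g; fixing one, it fixes
both, which no involution does. *)
Lemma norm_involution_eq1 g x y t : g \in G -> g != 1 ->
    x != y -> x \in Fix g -> y \in Fix g ->
  t \in G -> t * t = 1 -> t \in 'N(<[g]>) -> t x = x -> t = 1.
Proof.
move=> gG ng1 nxy gx gy tG tt tN tx; apply/eqP/negPn/negP=> nt1.
have nty : t y != y.
  by apply: contra nt1 => /eqP ty; apply/eqP; apply: (involution_fix1 _ tG tt nxy).
have nxty : x != t y by apply: contra nxy => /eqP; rewrite -{1}tx => /perm_inj->.
have := Fix_norm tN gy; move: gx gy; rewrite !in_Fix => /eqP gx /eqP gy /eqP gty.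
case/eqP: ng1; apply: (fix3_eq1 gG _ gx gy gty).
by rewrite /= !inE negb_or nxy nxty eq_sym nty.
Qed.

Lemma card_orbit_cycle g x : prime #[g] -> g x != x ->
  #|orbit 'P <[g]> x| = #[g].
Proof.
move=> prg gx; have := card_orbit_stab 'P <[g]> x; rewrite -orderE => oc.
suff n1 : #|orbit 'P <[g]> x| != 1%N.
  by apply/(prime_nt_dvdP prg n1); rewrite -oc dvdn_mulr.
apply: contra gx => /eqP/card_orbit1 o1.
by have := mem_orbit 'P x (cycle_id g); rewrite o1 inE.
Qed.

Variable B : {set option F}.
Local Notation H := ('N_G(B | 'P)).

Lemma mem_stab s : s \in H -> s \in G /\ forall x, (s x \in B) = (x \in B).
Proof. by case/setIP=> sG /astabsP sB. Qed.

Lemma fix_mod g : g \in H -> prime #[g] ->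
  #|B :&: Fix g| = #|B| %[mod #[g]].
Proof.
move=> gH prg; have /setIP[_ gB] := gH.
rewrite -(afix_cycle 'P g); apply/esym/pgroup_fix_mod.
  by rewrite /pgroup -orderE pnat_id.
by rewrite cycle_subG.
Qed.

(** An involution that fixes x and inverts g maps g^i(x) to g^-i(x), and it
permutes the fixed points of g; so it maps B to itself as soon as B is made of
one g-cycle and of either none or all of the fixed points of g. *)
Lemma stab_inverting g x : g \in H -> x \in B -> g x != x -> g (g x) != x ->
    B \subset Fix g :|: orbit 'P <[g]> x ->
    (B :&: Fix g = set0) \/ (Fix g \subset B) ->
  exists t, [/\ t \in H, t != 1, t * t = 1, t x = x & g ^ t = g^-1].
Proof.
move=> gH xB gx ggx Bsub BF; have [gG gB] := mem_stab gH.
have [t [tG nt1 tt tx gt]] := inverting_involution gG gx ggx.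
exists t; split=> //; apply/setIP; split=> //; apply/setIP.
split; first exact: in_setT.
rewrite inE; apply/subsetP=> y yB.
rewrite inE /= apermE; have /setUP[yF|/orbitP[h /cycleP[i ->]]] := subsetP Bsub y yB.
  have tN : t \in 'N(<[g]>).
    by rewrite inE -cycleJ gt cycleV.
  case: BF => [B0|FB]; last exact/(subsetP FB)/Fix_norm.
  by have: y \in B :&: Fix g; [exact/setIP | rewrite B0 inE].
rewrite /= apermE => <-.
have -> : t ((g ^+ i) x) = (g ^+ i ^ t) x.
  by rewrite /conjg !permM -{2}tx permK.
rewrite conjXg gt; have /mem_stab[_ ->] // : g^-1 ^+ i \in H.
by rewrite groupX ?groupV.
Qed.

Lemma nonfixed_orbit g x : g \in H -> prime #[g] ->
  #|B :\: Fix g| = #[g] -> x \in B :\: Fix g ->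
  orbit 'P <[g]> x = B :\: Fix g.
Proof.
move=> gH prg cB /setDP[xB xF]; apply/eqP; rewrite eqEcard cB.
rewrite card_orbit_cycle -?in_Fix // leqnn andbT.
apply/subsetP=> _ /orbitP[h hg <-]; rewrite /= apermE; apply/setDP; split.
  by have /mem_stab[_ ->] : h \in H by apply: subsetP hg; rewrite cycle_subG.
apply: contra xF => hxF; rewrite -(permK h x); apply: Fix_norm => //.
by rewrite groupV (subsetP (normG _)).
Qed.

Lemma nonfixed_inverting g x : g \in H -> prime #[g] -> 2 < #[g] ->
    #|B :\: Fix g| = #[g] -> x \in B :\: Fix g ->
    (B :&: Fix g = set0) \/ (Fix g \subset B) ->
  exists t, [/\ t \in H, t != 1, t * t = 1, t x = x & g ^ t = g^-1].
Proof.
move=> gH prg g_gt2 cB xBF BF; have /setDP[xB xF] := xBF.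
have ox := nonfixed_orbit gH prg cB xBF.
have gx : g x != x by rewrite -in_Fix.
apply: stab_inverting => //; last first.
  apply/subsetP=> y yB; rewrite ox inE [in X in _ || X]inE yB andbT.
  by case: (y \in Fix g).
apply/eqP=> ggx; have co := card_orbit_cycle prg gx.
have g2 : g ^+ 2 \in 'C_<[g]>[x | 'P].
  by apply/setIP; split; [exact: mem_cycle | apply/astab1P; rewrite /= apermE permM].
have := card_orbit_stab 'P <[g]> x; rewrite co -orderE => /eqP.
rewrite -{2}[#[g]]muln1 eqn_pmul2l ?order_gt0 // => /eqP c1.
have /eqP : g ^+ 2 = 1.
  by move: g2; rewrite (card1_trivg c1) => /set1P.
by rewrite -order_dvdn => /(@dvdn_leq _ 2 isT); rewrite leqNgt g_gt2.
Qed.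

Hypothesis cardB : #|B| = 13.

Lemma card_BFix g : g \in H -> prime #[g] -> 2 < #[g] ->
  #|B :&: Fix g| = 13 %% #[g].
Proof.
move=> gH prg g_gt2; have := fix_mod gH prg; rewrite cardB.
rewrite (modn_small (m := #|_|)) //; apply: leq_ltn_trans g_gt2.
apply: leq_trans (subset_leq_card (subsetIr _ _)) _.
apply: card_Fix_le2; first by case/mem_stab: gH.
by rewrite -order_gt1 prime_gt1.
Qed.

Lemma involution_point t : t \in H -> t != 1 -> t * t = 1 ->
  exists2 x, x \in B & t x = x.
Proof.
move=> tH nt1 tt.
have o2 : #[t] = 2.
  by apply/prime_nt_dvdP; rewrite ?order_eq1 // order_dvdn expgS expg1 tt.
have := @fix_mod t tH; rewrite o2 cardB => /(_ isT).
case: (set_0Vmem (B :&: Fix t)) => [->|[x]]; first by rewrite cards0.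
by case/setIP=> xB; rewrite in_Fix => /eqP tx _; exists x.
Qed.

Lemma card_stab_neq6 : #|H| != 6.
Proof.
apply/eqP=> cH.
have [r rH o3] : {r | r \in H & #[r] = 3} by apply: Cauchy; rewrite ?cH.
have [t tH o2] : {t | t \in H & #[t] = 2} by apply: Cauchy; rewrite ?cH.
have [[rG _] [tG tB]] := (mem_stab rH, mem_stab tH).
have tt : t * t = 1 by apply/eqP; rewrite -[_ * _]/(t ^+ 2) -order_dvdn o2.
have nr1 : r != 1 by rewrite -order_gt1 o3.
have rN : t \in 'N(<[r]>).
  apply: (subsetP (normal_norm _)) tH; apply: index2_normal.
    by rewrite cycle_subG.
  by rewrite -divgS ?cycle_subG // cH -orderE o3.
have /eqP/cards1P[x BF] : #|B :&: Fix r| = 1%N by rewrite card_BFix ?o3.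
have /setIP[xB xF] : x \in B :&: Fix r by rewrite BF set11.
have tx : t x = x.
  by apply/set1P; rewrite -BF inE tB xB Fix_norm.
case: (pickP [pred y in Fix r | y != x]) => [y /andP[yF nyx] | only].
  have t1 := norm_involution_eq1 rG nr1 _ xF yF tG tt rN tx.
  by move: o2; rewrite t1 ?order1 // eq_sym.
have /eqP : r * r = 1.
  apply: (fix1_involution char2 rG (x := x)); first by apply/eqP; rewrite -in_Fix.
  move=> y ry; apply/eqP/negPn; have := only y; rewrite /= in_Fix ry eqxx.
  by move=> /= ->.
by rewrite -[_ * _]/(r ^+ 2) -order_dvdn o3.
Qed.

Hypothesis dvdH : #|H| %| 1716.

(** The involutions of H at a common fixed point commute, so with 1 they form a
2-group, of order at most 4 because 8 does not divide 1716. An element of order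
11 acting on it by conjugation moves nothing, its nontrivial cycles being too
long. *)
Lemma involution_cent g z t : g \in H -> #[g] = 11 -> z \in Fix g ->
  t \in H -> t * t = 1 -> t z = z -> t \in 'C(<[g]>).
Proof.
move=> gH og zF tH tt tz; pose K := [set s in H | (s * s == 1) && (s z == z)].
have inK s : reflect [/\ s \in H, s * s = 1 & s z = z] (s \in K).
  by apply: (iffP setIdP) => [[sH /andP[/eqP ? /eqP ?]] | [? -> ->]]; rewrite ?eqxx.
have gsK : group_set K.
  apply/group_setP; split; first by apply/inK; rewrite group1 mulg1 perm1.
  move=> s u /inK[sH ss sz] /inK[uH uu uz]; apply/inK.
  rewrite groupM // permM sz uz; split=> //.
  have [[sG _] [uG _]] := (mem_stab sH, mem_stab uH).
  rewrite {2}(involutions_commute char2 sG uG ss uu sz uz).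
  by rewrite mulgA -(mulgA s) uu mulg1.
have K4 : #|Group gsK| <= 4.
  have /p_natP[k ck] : 2.-group (Group gsK).
    apply/pgroupP=> p prp /(Cauchy prp)[s /inK[_ ss _] os].
    have : p %| 2 by rewrite -os order_dvdn; apply/eqP.
    by rewrite (dvdn_prime2 prp).
  have : 2 ^ k %| 1716.
    rewrite -ck; apply: dvdn_trans dvdH; apply: cardSg.
    by apply/subsetP=> s /inK[].
  rewrite ck; case: (leqP k 2) => [k2 _ | k3 d]; first by rewrite (leq_pexp2l _ k2).
  by have := dvdn_trans (dvdn_exp2l 2 k3) d.
have gK : g \in 'N(K).
  rewrite inE; apply/subsetP=> _ /imsetP[s /inK[sH ss sz] ->]; apply/inK.
  move: zF; rewrite in_Fix => /eqP gz.
  rewrite groupJ // -conjMg ss conj1g; split=> //.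
  by rewrite /conjg !permM -{1}gz permK sz.
have := @pgroup_fix_mod _ _ _ 'J 11 <[g]> K.
rewrite /pgroup -orderE og cycle_subG /= astabsJ gK pnat_id // => /(_ isT isT).
rewrite afixJ.
have KC4 : #|K :&: 'C(<[g]>)| <= 4.
  exact: leq_trans (subset_leq_card (subsetIl _ _)) K4.
rewrite !modn_small; [ | exact: leq_ltn_trans KC4 _ | exact: leq_ltn_trans K4 _].
move=> cK; have /eqP KC : K :&: 'C(<[g]>) == K by rewrite eqEcard subsetIl cK /=.
by have : t \in K by [apply/inK]; rewrite -KC => /setIP[].
Qed.

Lemma card_stab_11 : 11 %| #|H| -> #|H| = 22.
Proof.
move=> d11; have [g gH og] : {g | g \in H & #[g] = 11} by apply: Cauchy.
have prg : prime #[g] by rewrite og.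
have [gG gB] := mem_stab gH.
have ng1 : g != 1 by rewrite -order_gt1 og.
have cBF : #|B :&: Fix g| = 2 by rewrite card_BFix // og.
have FB : Fix g \subset B.
  rewrite (_ : Fix g = B :&: Fix g) ?subsetIl //; apply/esym/eqP.
  by rewrite eqEcard subsetIr cBF card_Fix_le2.
have cBD : #|B :\: Fix g| = 11.
  by apply/eqP; rewrite -(eqn_add2l 2) -{1}cBF cardsID cardB.
have other z : exists2 y, y \in Fix g & y != z.
  have /card_gt1P[u [v [/setIP[_ uF] /setIP[_ vF] nuv]]] : 1 < #|B :&: Fix g|.
    by rewrite cBF.
  case: (eqVneq u z) => [uz|]; last by exists u.
  by exists v; rewrite // -uz eq_sym.
have no_inv z t : z \in Fix g -> t \in H -> t * t = 1 -> t z = z -> t = 1.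
  move=> zF tH tt tz; have tC := involution_cent gH og zF tH tt tz.
  have [y yF nyz] := other z.
  have [tG _] := mem_stab tH.
  apply: (norm_involution_eq1 gG ng1 _ zF yF tG tt _ tz); first by rewrite eq_sym.
  exact: subsetP (cent_sub _) _ tC.
have [x xBD] : exists x, x \in B :\: Fix g by apply/set0Pn; rewrite -card_gt0 cBD.
have [t [tH nt1 tt _ _]] : exists t,
    [/\ t \in H, t != 1, t * t = 1, t x = x & g ^ t = g^-1].
  by apply: nonfixed_inverting; rewrite ?og ?cBD //; right.
have [y yB ty] := involution_point tH nt1 tt.
have yF : y \notin Fix g by apply: contra nt1 => yF; rewrite (no_inv y t).
have oy : orbit 'P <[g]> y = B :\: Fix g.
  by apply: nonfixed_orbit; rewrite ?og ?cBD // inE yF.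
(* Otherwise s z and the fixed point y of t lie in the same g-cycle, and a
     conjugate of t is an involution at z. *)
have FH s z : s \in H -> z \in Fix g -> s z \in Fix g.
  move=> sH zF; apply/negPn/negP=> nsz.
  have : s z \in B :\: Fix g.
    by have [_ sB] := mem_stab sH; rewrite inE nsz sB (subsetP FB).
  rewrite -oy => /orbitP[h hg /= ehy].
  have hH : h \in H by apply: subsetP hg; rewrite cycle_subG.
  pose u := s * h^-1; have uH : u \in H by rewrite groupM ?groupV.
  have uz : u z = y by rewrite permM -ehy apermE permK.
  case/eqP: nt1; apply/eqP; rewrite -(conjg_eq1 t u^-1); apply/eqP.
  apply: (no_inv z); rewrite ?groupJ ?groupV // -?conjMg ?tt ?conj1g //.
  by rewrite conjVE uz ty -uz permK.
have [z zF] : exists z, z \in Fix g.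
  have /card_gt0P[z /setIP[_ zF]] : 0 < #|B :&: Fix g| by rewrite cBF.
  by exists z.
(* The stabilizer of z fixes the other fixed point of g too, so it acts freely
     on the 11 points of B moved by g. *)
have le22 : #|H| <= 2 * 11.
  rewrite -(card_orbit_stab 'P [group of H] z) leq_mul //.
    rewrite -cBF subset_leq_card //; apply/subsetP=> _ /orbitP[s sH <-].
    by rewrite /= apermE inE FH // (subsetP FB) // FH.
  rewrite -(card_orbit_stab 'P [group of 'C_H[z | 'P]] y) -[11]muln1 leq_mul //.
    rewrite -cBD subset_leq_card //; apply/subsetP=> _ /orbitP[s /setIP[sH _] <-].
    have [_ sB] := mem_stab sH.
    rewrite /= apermE inE sB yB andbT; apply: contra yF => /(FH s^-1).
    by rewrite permK groupV; apply.
  rewrite (_ : 'C_('C_H[z | 'P])[y | 'P] = 1) ?cards1 //.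
  apply/trivgP/subsetP=> s /setIP[/setIP[sH /astab1P sz] /astab1P sy].
  rewrite /= !apermE in sz sy.
  have [u uF nuz] := other z.
  have sFz : s z \in Fix g := FH s z sH zF.
  have su : s u = u.
    apply/eqP/negPn/negP=> nsu; case/eqP: ng1.
    have nsuz : s u != z by apply: contra nuz => /eqP; rewrite -{1}sz => /perm_inj->.
    move: zF uF (FH s u sH uF); rewrite !in_Fix => /eqP gz /eqP gu /eqP gsu.
    apply: (fix3_eq1 gG _ gz gu gsu).
    by rewrite /= !inE negb_or eq_sym nuz eq_sym nsuz eq_sym nsu.
  have [sG _] := mem_stab sH; apply/set1P; apply: (fix3_eq1 sG _ sz su sy).
  have yz : y != z by apply: contra yF => /eqP->.
  have yu : y != u by apply: contra yF => /eqP->.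
  by rewrite /= !inE negb_or eq_sym nuz eq_sym yz eq_sym yu.
have d2 : 2 %| #|H|.
  have ot : #[t] = 2.
    by apply/prime_nt_dvdP; rewrite ?order_eq1 // order_dvdn expgS expg1 tt.
  by rewrite -ot order_dvdG.
have : 22 %| #|H| by rewrite (@Gauss_dvd 2 11) // d2 d11.
by move=> /(dvdn_leq (cardG_gt0 _)) ge22; apply/eqP; rewrite eqn_leq le22.
Qed.

Lemma card_stab_13 : 13 %| #|H| -> ~~ (11 %| #|H|) -> #|H| = 26.
Proof.
move=> d13 nd11; have [g gH og] : {g | g \in H & #[g] = 13} by apply: Cauchy.
have prg : prime #[g] by rewrite og.
have [gG gB] := mem_stab gH.
have BF0 : B :&: Fix g = set0 by apply/eqP; rewrite -cards_eq0 card_BFix // og.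
have BDF : B :\: Fix g = B by apply/setDidPl; rewrite -setI_eq0 BF0.
have d156 : #|H| %| 156.
  have : #|H| %| 156 * 11 by [].
  by rewrite Gauss_dvdl // coprime_sym prime_coprime.
(* The number of Sylow 13-subgroups is 1 modulo 13 and divides 12. *)
have gN : H \subset 'N(<[g]>).
  have sylP : 13.-Sylow(H) <[g]>.
    rewrite pHallE cycle_subG gH -orderE og /= p_part.
    suff -> : logn 13 #|H| = 1%N by [].
    apply/eqP; rewrite eqn_leq; apply/andP; split.
      exact: (dvdn_leq_log 13 _ d156).
    by rewrite -(@pfactor_dvdn 13 1) // cardG_gt0.
  have n1 := @card_Syl_mod 13 _ [group of H] isT.
  have := card_Syl sylP; move: n1.
  have : #|'Syl_13(H)| %| #|H| by apply: card_Syl_dvd.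
  set m := #|'Syl_13(H)| => dm m1 mE.
  have {}dm : m %| 12.
    have : m %| 12 * 13 by apply: dvdn_trans d156.
    by rewrite Gauss_dvdl // /coprime -gcdn_modl m1.
  have : m = 1%N.
    have : m <= 12 by apply: dvdn_leq.
    by move=> m12; rewrite -m1 modn_small.
  rewrite mE => /eqP; rewrite indexg_eq1 => /subset_trans; apply; exact: subsetIr.
have [x xB] : exists x, x \in B by apply/set0Pn; rewrite -card_gt0 cardB.
have xBD : x \in B :\: Fix g by rewrite BDF.
have ox : orbit 'P <[g]> x = B by rewrite (nonfixed_orbit gH) ?BDF ?cardB ?og.
have [t [tH nt1 tt tx _]] : exists t,
    [/\ t \in H, t != 1, t * t = 1, t x = x & g ^ t = g^-1].
  by apply: nonfixed_inverting; rewrite ?BDF ?og ?cardB //; left.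
pose Hx := [group of 'C_H[x | 'P]].
have sHx : Hx \subset 'N(<[g]>) := subset_trans (subsetIl _ _) gN.
have cHx : #|H| = (13 * #|Hx|)%N.
  rewrite -(card_orbit_stab 'P [group of H] x); congr (_ * _)%N.
  rewrite -cardB; congr #|pred_of_set _|; apply/eqP; rewrite eqEsubset.
  apply/andP; split; last first.
    have : orbit 'P <[g]> x \subset orbit 'P H x.
      by apply: imsetS; rewrite cycle_subG.
    by rewrite ox.
  apply/subsetP=> _ /orbitP[s sH <-].
  by have [_ sB] := mem_stab sH; rewrite /= apermE sB.
have cycHx : cyclic Hx.
  pose f := restrm_morphism sHx (conj_aut_morphism <[g]>).
  (* An element centralizing g and fixing x fixes the whole cycle B of x. *)
  have injf : 'injm f.
    rewrite ker_restrm ker_conj_aut; apply/subsetP=> s.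
    case/setIP=> /setIP[sH /astab1P sx] sC.
    rewrite /= apermE in sx.
    have [sG _] := mem_stab sH.
    have sfix y : y \in B -> s y = y.
      rewrite -ox => /orbitP[h hg <-]; rewrite /= apermE -permM.
      by rewrite -(centP sC) // permM sx.
    have /card_gt2P[u [v [w [[uB vB wB] [uv vw wu]]]]] : 2 < #|B| by rewrite cardB.
    apply/set1P; apply: (fix3_eq1 sG _ (sfix u uB) (sfix v vB) (sfix w wB)).
    by rewrite /= !inE negb_or uv vw eq_sym wu.
  rewrite -(injm_cyclic injf) //; apply: (@cyclicS _ (Aut_group <[g]>)) (Aut_prime_cyclic prg).
  by rewrite /= morphim_restrm Aut_conj_aut.
have /cyclicP[s Hxs] := cycHx.
have /setIP[sH /astab1P] : s \in Hx by rewrite Hxs cycle_id.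
rewrite /= apermE => sx; have [sG _] := mem_stab sH.
have tHx : t \in Hx by apply/setIP; split=> //; apply/astab1P; rewrite /= apermE.
have ss : s * s = 1.
  apply: (fix1_involution char2 sG sx) => y sy.
  move: tHx; rewrite Hxs => /cycleP[i ti].
  have ty : t y = y.
    by rewrite ti; elim: i {ti} => [|i IHi]; rewrite ?perm1 // expgS permM sy.
  apply/eqP/negPn/negP=> nyx; case/eqP: nt1.
  by have [tG _] := mem_stab tH; apply: (involution_fix1 char2 tG tt nyx).
(* Hx = <[s]> contains t, so it is not trivial. *)
rewrite cHx; suff -> : #|Hx| = 2 by [].
rewrite Hxs -orderE; apply/prime_nt_dvdP => //; last first.
  by rewrite order_dvdn expgS expg1 ss.
rewrite order_eq1; apply: contra nt1 => /eqP s1.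
by move: tHx; rewrite Hxs s1 cycle1 => /set1P->.
Qed.

End BlockStabilizer.

(** * The index of the design *)

Section Counting.
Local Open Scope group_scope.

Variable F : finFieldType.
Local Notation G := (PSL2 F).

(** By sharp 3-transitivity s is determined by the s-preimages of oo, 0, 1, and
these can be any three distinct points of B. *)
Lemma card_frames (B : {set option F}) :
  #|[set s in G | [set None; Some 0%R; Some 1%R] \subset ('P^*)%act B s]|
    = #|B| ^_ 3.
Proof.
pose t0 : 3.-tuple (option F) := [tuple None; Some 0%R; Some 1%R].
have ut0 : uniq t0.
  by rewrite /= !inE !andbT /=; apply/eqP=> -[/eqP]; rewrite eq_sym oner_eq0.
have actE s x : (x \in ('P^*)%act B s) = (s^-1 x \in B).
  rewrite -[(_ B s)%act]/[set s y | y in B] -{1}(permKV s x).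
  by rewrite mem_imset //; apply: perm_inj.
rewrite -(card_uniq_tuples 3 (mem B)).
rewrite -(card_in_imset (f := fun s : {perm option F} => map_tuple s^-1 t0)).
  apply: eq_card => t; apply/imsetP/idP => [[s /setIdP[sG /subsetP sB] ->]|].
    rewrite inE (map_inj_uniq (@perm_inj _ _)) ut0 andbT.
    apply/allP=> _ /mapP[y yt ->]; suff: y \in ('P^*)%act B s by rewrite actE.
    by apply: sB; move: yt; rewrite !inE orbA.
  rewrite inE => /andP[/allP tB ut].
  have [x [y [z tE]]] : exists x y z, t = [tuple x; y; z].
    case: t {tB ut} => -[|x [|y [|z [|]]]] //= st.
    by exists x, y, z; apply: val_inj.
  have [w wG [wx wy wz]] : exists2 w, w \in G &
    [/\ w None = x, w (Some 0%R) = y & w (Some 1%R) = z].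
    by apply: PSL2_frame; move: ut; rewrite tE.
  exists w^-1; last by apply: val_inj; rewrite tE /= invgK wx wy wz.
  apply/setIdP; split; first by rewrite groupV.
  apply/subsetP=> u; rewrite actE invgK !inE -orbA => /or3P[]/eqP->.
  - by rewrite wx; apply: tB; rewrite tE !inE eqxx.
  - by rewrite wy; apply: tB; rewrite tE !inE eqxx orbT.
  - by rewrite wz; apply: tB; rewrite tE !inE eqxx !orbT.
move=> s t /setIdP[sG _] /setIdP[tG _] /(congr1 val)[e0 e1 e2].
by apply: invg_inj; apply: (PSL2_eq3 _ _ ut0); rewrite ?groupV.
Qed.

(** Sort the elements s of [card_frames] by the block s(B): there are lam
blocks, and the elements giving the same block form a coset of the stabilizer. *)
Lemma design_index_stab (B : {set option F}) v lam :
  is_design 3 v #|B| lam (orbit 'P^* G B) ->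
  (lam * #|'N_G(B | 'P)|)%N = #|B| ^_ 3.
Proof.
case=> _ _ /(_ [set None; Some 0%R; Some 1%R]) <-; last first.
  rewrite -setUA cardsU1 cards2 !inE /=.
  by case: eqP => // -[/eqP]; rewrite eq_sym oner_eq0.
set S := [set _; _; _].
rewrite -card_frames -/S -[RHS]sum1_card.
rewrite (partition_big ('P^* B)%act
  (mem [set A in orbit 'P^* G B | S \subset A])) /=.
  rewrite -sum_nat_const; apply: eq_bigr => A.
  move=> /setIdP[/orbitP[a aG <-]] SA.
  rewrite sum1_card -astab1_set -(card_rcoset _ a) -amove_act ?subsetT //.
  apply: eq_card => s; apply/setIdP/andP.
    by case=> sG /eqP sa; split; [apply/setIdP; rewrite sa | apply/eqP].
  by case=> /setIdP[].
by move=> s /setIdP[sG sS]; rewrite inE sS andbT; apply: mem_orbit.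
Qed.

End Counting.

Theorem theorem3p9 (n : nat) (hn : 1 <= n)
  (F : finFieldType) (hF : #|F| = 2 ^ n)
  (B : {set option F}) (hB : #|B| = 13) (lambdaB : nat)
  (hD : is_design 3 (2 ^ n + 1) 13 lambdaB (orbit 'P^* (PSL2 F) B)) :
  lambdaB \in [:: 66; 78; 143; 429; 572; 858; 1716].
Proof.
have char2 : 2 \in [pchar F]%R by apply: card_finPcharP hF _.
rewrite -hB in hD; have := design_index_stab hD.
rewrite hB; set h := #|_|; rewrite -[13 ^_ 3]/1716 => e.
have dvdh : h %| 1716 by rewrite -e dvdn_mull.
have := card_stab_neq6 char2 hB; rewrite -/h.
have := card_stab_11 char2 hB dvdh; rewrite -/h.
have := card_stab_13 char2 hB dvdh; rewrite -/h.
move=> h13 h11 h6.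
suff : h \in [:: 26; 22; 12; 4; 3; 2; 1].
  rewrite !inE => /orP[/eqP|/or4P[/eqP|/eqP|/eqP|/or3P[/eqP|/eqP|/eqP]]] hE;
    by rewrite hE in e; lia.
have [/h11->//|nd11] := boolP (11 %| h).
have [/h13->//|nd13] := boolP (13 %| h).
have : h %| 12.
  have : h %| 12 * 13 * 11 by [].
  by rewrite !Gauss_dvdl // coprime_sym prime_coprime.
move=> d12; have : h <= 12 by apply: dvdn_leq.
move: h d12 h6 {e dvdh h13 h11 nd11 nd13}; do 13 case=> //.
Qed.
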